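(* Let $G$ be an absolutely continuous baseline cumulative distribution function with probability density function $g$, and let $\alpha>0$, $a>0$, $b>0$. Let $f$, $F$ and $h$ be the pdf, cdf and hazard rate function of the $MOKw$-$G$ distribution with parameters $\alpha,a,b$ and baseline $G$. Then, as $G(t)\to 0$, $$f(t)\sim\frac{a\,b\,g(t)\,G(t)^{a-1}}{\alpha},\qquad F(t)\to 0,\qquad h(t)\sim\frac{a\,b\,g(t)\,G(t)^{a-1}}{\alpha}.$$
   Context: With $\bar\alpha=1-\alpha$, the $MOKw$-$G$ (Marshall-Olkin-Kumaraswamy-$G$) distribution has pdf $$f(t)=\frac{\alpha\,a\,b\,g(t)\,G(t)^{a-1}[1-G(t)^a]^{b-1}}{\left[1-\bar\alpha\,[1-G(t)^a]^b\right]^2},$$ cdf $$F(t)=\frac{1-[1-G(t)^a]^b}{1-\bar\alpha\,[1-G(t)^a]^b},$$ and hazard rate function $$h(t)=\frac{f(t)}{1-F(t)}=\frac{a\,b\,g(t)\,G(t)^{a-1}[1-G(t)^a]^{-1}}{1-\bar\alpha\,[1-G(t)^a]^b}.$$ Here $u(t)\sim v(t)$ means $u(t)=(1+o(1))\,v(t)$ in the indicated limit, and $t$ ranges over points with $0<G(t)<1$. The limit ''as $G(t)\to 0$'' means along values of $t$ for which $G(t)$ tends to $0$. *)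

(* Defs.v *)
From mathcomp Require Import all_boot all_order all_algebra.
From mathcomp Require Import all_classical all_reals all_analysis.
From mathcomp Require Import ring lra.
Set Implicit Arguments.
Unset Strict Implicit.
Unset Printing Implicit Defensive.
Import Order.TTheory GRing.Theory Num.Theory.
Import numFieldNormedType.Exports.
Local Open Scope classical_set_scope.
Local Open Scope ring_scope.

Definition is_pdf (R : realType) (g : R -> R) : Prop :=
  [/\ measurable_fun [set: R] g,
      (forall x, 0 <= g x) &
      (\int[lebesgue_measure]_(x in [set: R]) (g x)%:E = 1)%E].

(* [G] is an absolutely continuous cumulative distribution function and [g] is
   its density. *)
Definition abs_cont_cdf (R : realType) (G g : R -> R) : Prop :=
  is_pdf g /\
  forall t, ((G t)%:E = \int[lebesgue_measure]_(x in `]-oo, t]) (g x)%:E)%E.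

Definition mokw_pdf (R : realType) (alpha a b : R) (G g : R -> R) (t : R) : R :=
  (alpha * a * b * g t * (G t `^ (a - 1)) * ((1 - G t `^ a) `^ (b - 1))) /
  (1 - (1 - alpha) * ((1 - G t `^ a) `^ b)) ^+ 2.

Definition mokw_cdf (R : realType) (alpha a b : R) (G : R -> R) (t : R) : R :=
  (1 - (1 - G t `^ a) `^ b) / (1 - (1 - alpha) * ((1 - G t `^ a) `^ b)).

Definition mokw_hazard (R : realType) (alpha a b : R) (G g : R -> R) (t : R) : R :=
  mokw_pdf alpha a b G g t / (1 - mokw_cdf alpha a b G t).

(* The limit "as G(t) -> 0": the pullback along [G] of the neighbourhoods of 0,
   restricted to the points [t] with 0 < G(t) < 1. *)
Definition baseline_to0 (R : realType) (G : R -> R) : set_system R :=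
  within [set t | 0 < G t < 1] (filter_from (nbhs (0 : R)) (fun A => G @^-1` A)).

Definition asymp_equiv (R : realType) (F : set_system R) (u v : R -> R) : Prop :=
  exists2 e : R -> R, e t @[t --> F] --> 0 &
    \forall t \near F, u t = (1 + e t) * v t.

Global Instance baseline_to0_filter (R : realType) (G : R -> R) :
  Filter (baseline_to0 G).
Proof.
apply: within_filter; apply: filter_from_filter; first by exists setT; exact: filterT.
by move=> A B nA nB; exists (A `&` B) => //; exact: filterI.
Qed.

Lemma near_baseline_to0 (R : realType) (G : R -> R) :
  \forall t \near baseline_to0 G, 0 < G t < 1.
Proof. by exists setT; [exact: filterT | move=> t _]. Qed.

Lemma baseline_to0_cvg (R : realType) (G : R -> R) :
  G t @[t --> baseline_to0 G] --> (0 : R).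
Proof. by move=> A nA; exists A => // t At _. Qed.

Lemma asymp_equivE (R : realType) (F : filter_on R)
    (u v : R -> R) : asymp_equiv F u v <-> u ~_F v.
Proof.
split=> [[e e0 uE]|uv].
  apply/eqaddoP => _/posnumP[d]; near=> t.
  have -> : (u - v) t = e t * v t.
    rewrite fctE (near uE t)//=; by rewrite mulrDl mul1r addrC addKr.
  rewrite normrM ler_wpM2r//; near: t.
  move/cvgrPdist_le : e0 => /(_ d%:num (gt0 d)).
  by apply: filterS => t; rewrite sub0r normrN.
have uvo : forall d, 0 < d -> \forall t \near F, `|u t - v t| <= d * `|v t|.
  by move/eqaddoP : uv => /[swap] d /[apply].
exists (fun t => if v t == 0 then 0 else (u t - v t) / v t).
  apply/cvgrPdist_le => d d0; near=> t; rewrite sub0r normrN.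
  case: ifPn => [_|v0]; first by rewrite normr0 ltW.
  rewrite normrM normfV ler_pdivrMr ?normr_gt0//.
  by near: t; exact: uvo.
near=> t.
case: eqVneq => [v0|v0]; last by rewrite mulrDl mul1r divfK// addrC subrK.
have : `|u t - v t| <= 1 * `|v t| by near: t; exact: uvo.
by rewrite v0 normr0 !mulr0 subr0 normr_le0 => /eqP.
Unshelve. all: by end_near. Qed.

Lemma mokw_hazardE (R : realType) (alpha a b : R) (G g : R -> R) (t : R) :
  0 < alpha -> 0 < a -> 0 < b -> 0 < G t < 1 ->
  mokw_hazard alpha a b G g t =
  a * b * g t * (G t `^ (a - 1)) * (1 - G t `^ a)^-1 /
  (1 - (1 - alpha) * ((1 - G t `^ a) `^ b)).
Proof.
move=> al0 a0 b0 /andP[G0 G1]; rewrite /mokw_hazard /mokw_pdf /mokw_cdf.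
have Ga1 : G t `^ a < 1.
  have := @gt0_ltr_powR R a a0 (G t) 1.
  by rewrite powR1 !nnegrE ler01 (ltW G0) => ->.
set y := 1 - G t `^ a.
have y0 : 0 < y by rewrite subr_gt0.
have y1 : y <= 1 by rewrite gerBl powR_ge0.
have -> : y `^ (b - 1) = y `^ b / y.
  by rewrite powRD; [rewrite powR_inv1 ?ltW | rewrite (gt_eqF y0) implybT].
have S0 : 0 < y `^ b by exact: powR_gt0.
have S1 : y `^ b <= 1.
  by have := @ge0_ler_powR R b (ltW b0) y 1; rewrite powR1 !nnegrE ler01 (ltW y0) => ->.
move: (y `^ b) S0 S1 => S S0 S1.
have D0 : 1 - (1 - alpha) * S != 0.
  by rewrite gt_eqF//; have aS := mulr_gt0 al0 S0; lra.
have al_neq0 : alpha != 0 by rewrite gt_eqF.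
have y_neq0 : y != 0 by rewrite gt_eqF.
have S_neq0 : S != 0 by rewrite gt_eqF.
have -> : 1 - (1 - S) / (1 - (1 - alpha) * S) = alpha * S / (1 - (1 - alpha) * S).
  by field.
by field; rewrite D0 y_neq0 al_neq0 S_neq0.
Qed.

(* Main.v *)
Require Import Defs.
From mathcomp Require Import all_boot all_order all_algebra.
From mathcomp Require Import all_classical all_reals all_analysis.
From mathcomp Require Import ring.
Import Order.TTheory GRing.Theory Num.Theory.
Import numFieldNormedType.Exports.
Local Open Scope classical_set_scope.
Local Open Scope ring_scope.

(** Put [y = 1 - G t `^ a] and [D = 1 - (1 - alpha) * y `^ b].  As [G t] tends
    to 0 from above, [G t `^ a] tends to 0 because [a > 0], so [y] and all its
    real powers tend to 1, and [D] tends to [1 - (1 - alpha) = alpha > 0].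

    The candidate equivalent [a b g(t) G(t)^(a-1) / alpha] already contains the
    only factors of the pdf and of the hazard rate that need not converge,
    namely [g t] and [G t `^ (a - 1)].  What remains is a quotient:
    [alpha^2 y^(b-1) / D^2] for the pdf and [alpha / (y D)] for the hazard rate
    (after its closed form [mokw_hazardE]).  Both tend to 1, which is the
    asserted equivalence ([asymp_equiv_ratio]); since the factorization is an
    identity, zeros of [g] need no separate treatment.  The cdf is
    [(1 - y^b) / D], which tends to [0 / alpha = 0]. *)

Section Asymptotics.
Context {R : realType}.
Implicit Types (G g : R -> R) (alpha a b p : R).

(** This form of equivalence allows [v] to vanish, where dividing [u] by [v]
    would lose information. *)
Lemma asymp_equiv_ratio {F : set_system R} {FF : Filter F} (r u v : R -> R) :
  r t @[t --> F] --> (1 : R) -> (\forall t \near F, u t = r t * v t) ->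
  asymp_equiv F u v.
Proof.
move=> r1 uE; exists (fun t => r t - 1); last first.
  by apply: filterS uE => t ->; rewrite addrC subrK.
by rewrite -(subrr 1); apply: cvgB => //; exact: cvg_cst.
Qed.

(** The restriction to [0 < G t] in [baseline_to0] makes the limit one-sided.
    This matters because [x `^ a] equals 1, not a small number, at negative
    [x]. *)
Lemma baseline_to0_at_right G : G t @[t --> baseline_to0 G] --> 0^'+.
Proof.
move=> A A0.
have GA : \forall t \near baseline_to0 G, 0 < G t -> A (G t).
  exact: (baseline_to0_cvg G A0).
apply: filterS2 (near_baseline_to0 G) GA.
by move=> t /andP[G0 _] At; exact: At.
Qed.

Lemma cvg_powR1 {T : Type} {F : set_system T} {FF : Filter F} (y : T -> R) p :
  y t @[t --> F] --> (1 : R) -> y t `^ p @[t --> F] --> (1 : R).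
Proof.
move=> y1; have limE : 1 `^ p = 1 :> R by rewrite powR1.
rewrite -[X in _ --> X]limE.
apply: (@continuous_cvg T R R F FF y (fun x => x `^ p) 1 _ y1).
apply: differentiable_continuous; apply/derivable1_diffP.
by apply: derivable_powR; rewrite in_itv/= ltr01.
Qed.

Lemma cvg_baseline_complement G a : 0 < a ->
  1 - G t `^ a @[t --> baseline_to0 G] --> (1 : R).
Proof.
move=> a0; rewrite -[X in _ --> X]subr0; apply: cvgB; first exact: cvg_cst.
exact: cvg_comp (baseline_to0_at_right G) (powR_cvg0 a0).
Qed.

Lemma cvg_mokw_denominator G alpha a b : 0 < a ->
  1 - (1 - alpha) * (1 - G t `^ a) `^ b @[t --> baseline_to0 G] --> alpha.
Proof.
move=> a0; have limE : 1 - (1 - alpha) * 1 = alpha by ring.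
rewrite -[X in _ --> X]limE.
apply: cvgB; first exact: cvg_cst.
by apply: cvgM; [exact: cvg_cst | exact/cvg_powR1/cvg_baseline_complement].
Qed.

Lemma mokw_pdf_equiv G g alpha a b : 0 < alpha -> 0 < a ->
  asymp_equiv (baseline_to0 G) (mokw_pdf alpha a b G g)
    (fun t => a * b * g t * (G t `^ (a - 1)) / alpha).
Proof.
move=> al0 a0; have al_neq0 : alpha != 0 by rewrite gt_eqF.
pose D t := 1 - (1 - alpha) * (1 - G t `^ a) `^ b.
apply: (asymp_equiv_ratio
  (fun t => alpha ^+ 2 * (1 - G t `^ a) `^ (b - 1) * (D t ^+ 2)^-1)).
  have limE : alpha ^+ 2 * 1 * (alpha ^+ 2)^-1 = 1.
    by rewrite mulr1 divff// expf_neq0.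
  rewrite -[X in _ --> X]limE.
  apply: cvgM.
    by apply: cvgM; [exact: cvg_cst | exact/cvg_powR1/cvg_baseline_complement].
  apply: cvgV; first by rewrite expf_neq0.
  by apply: cvgM; exact: cvg_mokw_denominator.
apply: nearW => t; rewrite /mokw_pdf -/(D t).
(* Generalizing the inverse keeps the identity valid even where [D t = 0]. *)
by move: ((D t ^+ 2)^-1) => d; field.
Qed.

Lemma mokw_cdf_cvg0 G alpha a b : 0 < alpha -> 0 < a ->
  mokw_cdf alpha a b G t @[t --> baseline_to0 G] --> (0 : R).
Proof.
move=> al0 a0; have limE : (1 - 1) * alpha^-1 = 0 by rewrite subrr mul0r.
rewrite -[X in _ --> X]limE.
apply: cvgM.
  apply: cvgB; first exact: cvg_cst.
  exact/cvg_powR1/cvg_baseline_complement.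
by apply: cvgV; [rewrite gt_eqF | exact: cvg_mokw_denominator].
Qed.

Lemma mokw_hazard_equiv G g alpha a b : 0 < alpha -> 0 < a -> 0 < b ->
  asymp_equiv (baseline_to0 G) (mokw_hazard alpha a b G g)
    (fun t => a * b * g t * (G t `^ (a - 1)) / alpha).
Proof.
move=> al0 a0 b0; have al_neq0 : alpha != 0 by rewrite gt_eqF.
pose D t := 1 - (1 - alpha) * (1 - G t `^ a) `^ b.
apply: (asymp_equiv_ratio
  (fun t => alpha * (1 - G t `^ a)^-1 * (D t)^-1)).
  have limE : alpha * 1^-1 * alpha^-1 = 1 by rewrite invr1 mulr1 divff.
  rewrite -[X in _ --> X]limE.
  apply: cvgM; last by apply: cvgV => //; exact: cvg_mokw_denominator.
  apply: cvgM; first exact: cvg_cst.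
  by apply: cvgV; [exact: oner_neq0 | exact: cvg_baseline_complement].
(* The closed form cancels a power of [1 - G t `^ a], which [G t < 1] makes
   nonzero; hence an eventual identity here instead of one for every [t]. *)
apply: filterS (near_baseline_to0 G) => t G01.
rewrite mokw_hazardE// -/(D t).
by move: ((1 - G t `^ a)^-1) ((D t)^-1) => y d; field.
Qed.

End Asymptotics.

Theorem proposition1 (R : realType) (G g : R -> R) (alpha a b : R)
    (hG : abs_cont_cdf G g) (halpha : 0 < alpha) (ha : 0 < a) (hb : 0 < b) :
  [/\ asymp_equiv (baseline_to0 G) (mokw_pdf alpha a b G g)
        (fun t => a * b * g t * (G t `^ (a - 1)) / alpha),
      mokw_cdf alpha a b G t @[t --> baseline_to0 G] --> 0 &
      asymp_equiv (baseline_to0 G) (mokw_hazard alpha a b G g)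
        (fun t => a * b * g t * (G t `^ (a - 1)) / alpha)].
Proof.
split.
- exact: mokw_pdf_equiv.
- exact: mokw_cdf_cvg0.
- exact: mokw_hazard_equiv.
Qed.
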